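(* Let $\mathscr{P}_A(X)\subseteq\mathscr{P}(X)$ be a convex set of input probability measures and let $W_{Q_v}(\cdot|x)$ denote a channel with side information. Assume there exists a capacity-achieving input measure $P_o\in\mathscr{P}_A(X)$, i.e. $I(P_o,W_{Q_v}|R)=\sup_{P\in\mathscr{P}_A(X)}I(P,W_{Q_v}|R)$. Suppose that for all distinct $P_1,P_2\in\mathscr{P}_A(X)$ and all $0<\alpha<1$, with $P=\alpha P_1+(1-\alpha)P_2$, the set $$E=\left\{(y,v)\in Y\times V:\ \frac{d(P_1W_{Q_v})}{d(PW_{Q_v})}\neq\frac{d(P_2W_{Q_v})}{d(PW_{Q_v})}\neq 0\right\}$$ satisfies $(PW_{Q_v}\times R)(E)>0$ (or, alternatively, that for some conditional probability measure $T_v$ on $Y$ with $PW_{Q_v}\ll T_v$ for all $v\in V$, the set $\{(y,v):\frac{d(P_1W_{Q_v})}{dT_v}\neq\frac{d(P_2W_{Q_v})}{dT_v}\neq 0\}$ has nonzero measure with respect to $T_v\times R$). Then the capacity-achieving measure $P_o$ is unique in $\mathscr{P}_A(X)$.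
   Context: Setting. $X,Y,S,V$ (input, output, state and side-information alphabets) are separable locally compact Hausdorff spaces (e.g. $\mathbb{R}^n$ or $\mathbb{C}^n$) with Borel $\sigma$-algebras $\mathcal{B}_X,\mathcal{B}_Y,\mathcal{B}_S,\mathcal{B}_V$. $\mathscr{P}(X)$ denotes the set of Radon probability measures on $(X,\mathcal{B}_X)$, and similarly for the other spaces. For each $x\in X$, $s\in S$, $W(\cdot|x,s)\in\mathscr{P}(Y)$; for each $v\in V$, $Q_v$ is a (conditional) probability measure on $(S,\mathcal{B}_S)$; $R$ is a probability measure on $(V,\mathcal{B}_V)$. All of these depend measurably on their parameters. The channel with side information is $W_{Q_v}(E|x)=\int W(E|x,s)\,dQ_v(s)$, $E\in\mathcal{B}_Y$. For $P\in\mathscr{P}(X)$, $PW_{Q_v}$ is the output measure $PW_{Q_v}(B)=\int W_{Q_v}(B|x)\,dP(x)$, $B\in\mathcal{B}_Y$. Relative entropy: $D(P\|Q)=\int\log_2\frac{dP}{dQ}\,dP$ if $P\ll Q$, and $+\infty$ otherwise. Mutual information: $I(P,W_{Q_v}|R)=\iint D(W_{Q_v}(\cdot|x)\|PW_{Q_v})\,dP(x)\,dR(v)$, regarded as a real-valued function on $\mathscr{P}_A(X)$. For a family $(T_v)_{v\in V}$ of probability measures on $Y$, $(T_v\times R)(E)=\int T_v(\{y:(y,v)\in E\})\,dR(v)$; likewise for $PW_{Q_v}\times R$. A chain $a\neq b\neq 0$ means $a\neq b$ and $b\neq 0$. *)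

(* Defs.v *)
From HB Require Import structures.
From mathcomp Require Import all_boot all_order all_algebra.
From mathcomp Require Import all_classical all_reals all_analysis.
From mathcomp Require Import measurable_realfun.
Set Implicit Arguments.
Unset Strict Implicit.
Unset Printing Implicit Defensive.
Import Order.TTheory GRing.Theory Num.Theory.
Import numFieldNormedType.Exports.
Local Open Scope classical_set_scope.
Local Open Scope ring_scope.
Local Open Scope ereal_scope.

Notation borel T := (g_sigma_algebraType (@open T)).

Definition separable (T : topologicalType) : Prop :=
  exists2 D : set T, countable D & dense D.

Definition sep_lch (T : ptopologicalType) : Prop :=
  [/\ separable T, locally_compact [set: T] & hausdorff_space T].

(* Radon measures in the usual sense for locally compact Hausdorff spaces:
   outer regularity on Borel sets, inner regularity on open sets. *)
Definition radon (K : realType) (T : ptopologicalType)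
    (mu : set (borel T) -> \bar K) : Prop :=
  [/\ forall C : set T, compact C -> mu C < +oo,
      forall B : set (borel T), measurable B ->
        mu B = ereal_inf [set mu U | U in [set U : set T | open U /\ B `<=` U]]
    & forall U : set T, open U ->
        mu U = ereal_sup [set mu C | C in [set C : set T | compact C /\ C `<=` U]]].

(* Elements of [probability T K] are functions on all subsets of T; as measures
   they are identified when they agree on the sigma-algebra. *)
Definition same_law d (T : measurableType d) (K : realType)
    (P1 P2 : probability T K) : Prop :=
  forall B, measurable B -> P1 B = P2 B.

Section mixture.
Context d (T : measurableType d) (K : realType).
Variables (t : {i01 K}) (P1 P2 : probability T K).

Definition mixture (B : set T) : \bar K :=
  (t%:num)%:E * P1 B + (1 - t%:num)%:E * P2 B.

Let t_ge0 : (0 <= t%:num)%R. Proof. by []. Qed.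

Let onem_ge0 : (0 <= 1 - t%:num)%R.
Proof. by rewrite subr_ge0. Qed.

Let mixtureE : mixture =
  measure_add (mscale (NngNum t_ge0) P1) (mscale (NngNum onem_ge0) P2).
Proof. by apply/funext => B; rewrite measure_addE. Qed.

Let mixture0 : mixture set0 = 0.
Proof. by rewrite /mixture !measure0 !mule0 adde0. Qed.

Let mixture_ge0 B : 0 <= mixture B.
Proof. by rewrite /mixture adde_ge0// mule_ge0// lee_fin. Qed.

Let mixture_sigma_additive : semi_sigma_additive mixture.
Proof. by rewrite mixtureE; exact: measure_semi_sigma_additive. Qed.

HB.instance Definition _ := isMeasure.Build _ _ _ mixture
  mixture0 mixture_ge0 mixture_sigma_additive.

Let mixture_setT : mixture setT = 1.
Proof.
rewrite /mixture [P1 _]probability_setT [P2 _]probability_setT.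
by rewrite !mule1 -EFinD addrC subrK.
Qed.

HB.instance Definition _ := Measure_isProbability.Build _ _ _ mixture mixture_setT.

End mixture.

Definition convex_laws d (T : measurableType d) (K : realType)
    (A : set (probability T K)) : Prop :=
  forall (P1 P2 : probability T K) (t : {i01 K}), A P1 -> A P2 ->
    A (mixture t P1 P2 : probability T K).

Section channel.
Context dX dY dS dV (X : measurableType dX) (Y : measurableType dY)
  (S : measurableType dS) (V : measurableType dV) (K : realType).
Variables (W : K.-pker (X * S) ~> Y) (Q : K.-pker V ~> S).

(* [channel v x] is W_{Q_v}(. | x) *)
Definition channel (v : V) (x : X) (E : set Y) : \bar K :=
  \int[Q v]_s W (x, s) E.

Section channel_probability.
Variables (v : V) (x : X).

Let channel0 : channel v x set0 = 0.
Proof. by rewrite /channel (eq_integral (cst 0)) ?integral0// => y _; rewrite measure0. Qed.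

Let channel_ge0 E : 0 <= channel v x E.
Proof. exact: integral_ge0. Qed.

Let channel_sigma_additive : semi_sigma_additive (channel v x).
Proof.
move=> F mF tF mUF; rewrite [X in _ --> X](_ : _ =
    \int[Q v]_s (\sum_(n <oo) W (x, s) (F n))); last first.
  apply: eq_integral => s _.
  by apply/esym/cvg_lim => //; exact: measure_semi_sigma_additive.
apply/cvg_closeP; split.
  by apply: is_cvg_nneseries => n _ _; exact: integral_ge0.
rewrite closeE// integral_nneseries// => n.
apply: (@measurable_fun_pair2 _ _ _ X S _ (fun xs => W xs (F n))).
exact: measurable_kernel.
Qed.

HB.instance Definition _ := isMeasure.Build _ _ _ (channel v x)
  channel0 channel_ge0 channel_sigma_additive.

Let channel_setT : channel v x setT = 1.
Proof.
rewrite /channel (eq_integral (cst 1)); last by move=> s _; rewrite prob_kernel.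
by rewrite integral_cst// mul1e prob_kernel.
Qed.

HB.instance Definition _ :=
  Measure_isProbability.Build _ _ _ (channel v x) channel_setT.

End channel_probability.

Lemma measurable_channel (v : V) (E : set Y) : measurable E ->
  measurable_fun [set: X] (fun x => channel v x E).
Proof.
pose q : set S -> \bar K := Q v.
pose iM := isMeasure.Build _ S K q (measure0 (Q v)) (measure_ge0 (Q v))
  (@measure_semi_sigma_additive _ _ _ (Q v)).
pose qm : {measure set S -> \bar K} := HB.pack q iM.
pose qp : probability S K := HB.pack q iM
  (Measure_isProbability.Build _ _ _ qm (prob_kernel v)).
move=> mE.
apply: (measurable_fun_fubini_tonelli_F (m2 := qp) (fun xs => W xs E)) => //.
exact: measurable_kernel.
Qed.

Section output.
Variables (P : probability X K) (v : V).

(* [output P v] is P W_{Q_v} *)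
Definition output (B : set Y) : \bar K := \int[P]_x channel v x B.

Let output0 : output set0 = 0.
Proof. by rewrite /output (eq_integral (cst 0)) ?integral0// => y _; rewrite measure0. Qed.

Let output_ge0 E : 0 <= output E.
Proof. exact: integral_ge0. Qed.

Let output_sigma_additive : semi_sigma_additive output.
Proof.
move=> F mF tF mUF; rewrite [X in _ --> X](_ : _ =
    \int[P]_x (\sum_(n <oo) channel v x (F n))); last first.
  apply: eq_integral => s _.
  by apply/esym/cvg_lim => //; exact: measure_semi_sigma_additive.
apply/cvg_closeP; split.
  by apply: is_cvg_nneseries => n _ _; exact: integral_ge0.
by rewrite closeE// integral_nneseries// => n; exact: measurable_channel.
Qed.

HB.instance Definition _ := isMeasure.Build _ _ _ output
  output0 output_ge0 output_sigma_additive.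

Let output_setT : output setT = 1.
Proof.
rewrite /output (eq_integral (cst 1)); last first.
  by move=> x _; exact: (probability_setT (channel v x)).
by rewrite integral_cst// mul1e [LHS]probability_setT.
Qed.

HB.instance Definition _ := Measure_isProbability.Build _ _ _ output output_setT.

End output.

Definition output_law (P : probability X K) (v : V) : probability Y K :=
  output P v.

End channel.

Definition density d (T : measurableType d) (K : realType)
    (nu mu : probability T K) : T -> \bar K :=
  Radon_Nikodym (charge_of_finite_measure nu) mu.

(* [ln 0 = 0] in the library, but the density vanishes only on a nu-null set. *)
Definition relative_entropy d (T : measurableType d) (K : realType)
    (nu mu : probability T K) : \bar K :=
  if `[< nu `<< mu >]
  then \int[nu]_y (ln (fine (density nu mu y)) / ln 2)%:E
  else +oo.

Section mutual_information.
Context dX dY dS dV (X : measurableType dX) (Y : measurableType dY)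
  (S : measurableType dS) (V : measurableType dV) (K : realType).
Variables (W : K.-pker (X * S) ~> Y) (Q : K.-pker V ~> S)
  (R : probability V K).

Definition state_information (P : probability X K) (v : V) : \bar K :=
  \int[P]_x relative_entropy (channel W Q v x) (output W Q P v).

Definition mutual_information (P : probability X K) : \bar K :=
  \int[R]_v state_information P v.

(* The Lebesgue integral defining the mutual information exists and is finite.
   Over a Borel sigma-algebra that is not countably generated, measurability in
   v does not follow from that of the kernels, and the library's integral of a
   nonnegative function is then only a lower integral. *)
Definition real_valued_information (P : probability X K) : Prop :=
  R.-integrable setT (state_information P).

Definition capacity_achieving (A : set (probability X K))
    (P : probability X K) : Prop :=
  A P /\ mutual_information P = ereal_sup [set mutual_information P' | P' in A].

End mutual_information.

Section families.
Context dY dV (Y : measurableType dY) (V : measurableType dV) (K : realType).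

Definition measurable_family (T : V -> probability Y K) : Prop :=
  forall B, measurable B -> measurable_fun [set: V] (fun v => T v B).

(* [family_product T R] is T_v x R *)
Definition family_product (T : V -> probability Y K) (R : probability V K)
    (E : set (Y * V)) : \bar K :=
  \int[R]_v T v [set y | E (y, v)].

Definition densities_differ (nu1 nu2 mu : V -> probability Y K) : set (Y * V) :=
  [set yv | let: (y, v) := yv in
    density (nu1 v) (mu v) y <> density (nu2 v) (mu v) y /\
    density (nu2 v) (mu v) y <> 0].

End families.

(* Main.v *)
(* Fix the side information v, let M = a P_1 + (1 - a) P_2, and write p_i for
   the output of P_i, m for the output of M, and J_v(P) for the mutual
   information at v. The compensation identity
     J_v(M) = a (J_v(P_1) + D(p_1 || m)) + (1 - a) (J_v(P_2) + D(p_2 || m))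
   makes the mutual information concave; if P_1 and P_2 both achieve the
   capacity, then the two divergences vanish for almost every v, so that
   p_1 = m = p_2, and no family T can separate the densities.

   The integrands x |-> D(W_v(. | x) || m) need not be measurable, so their
   integrals are lower integrals. These are superadditive, and additive along
   mixtures of measures, which gives the inequality >= of the identity. *)
Require Import Defs.
From HB Require Import structures.
From mathcomp Require Import all_boot all_order all_algebra.
From mathcomp Require Import all_classical all_reals all_analysis.
From mathcomp Require Import measurable_realfun.
From mathcomp Require Import giry.
Set Implicit Arguments.
Unset Strict Implicit.
Unset Printing Implicit Defensive.
Import Order.TTheory GRing.Theory Num.Theory.
Import numFieldNormedType.Exports.
Local Open Scope classical_set_scope.
Local Open Scope ring_scope.
Local Open Scope ereal_scope.

(** * Almost-everywhere comparison and additivity of integrals *)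

Section integral_lemmas.
Context d (T : measurableType d) (K : realType).
Variable mu : {measure set T -> \bar K}.
Implicit Types f g : T -> \bar K.

(** Splitting into positive and negative parts reduces to the nonnegative case; the difference of
    the two parts is monotone in the extended reals even when both are infinite. *)
Lemma ae_le_integral f g : measurable_fun setT f -> measurable_fun setT g ->
  {ae mu, forall x, f x <= g x} -> \int[mu]_x f x <= \int[mu]_x g x.
Proof.
move=> mf mg fg.
rewrite integralE [leRHS]integralE; apply: leeB.
- apply: ae_ge0_le_integral => //; try exact: measurable_funepos.
  apply: filterS fg => x fgx _.
  by rewrite !funeposE ge_max !le_max fgx lexx orbT.
- apply: ae_ge0_le_integral => //; try exact: measurable_funeneg.
  apply: filterS fg => x fgx _.
  by rewrite !funenegE ge_max !le_max leeN2 fgx lexx orbT.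
Qed.

Lemma ge0_integral_le0_ae f : measurable_fun setT f ->
  {ae mu, forall x, 0 <= f x} -> \int[mu]_x f x <= 0 ->
  {ae mu, forall x, f x = 0}.
Proof.
move=> mf f0 If.
have f_abs : {ae mu, forall x, setT x -> `|f x| = f x}.
  by apply: filterS f0 => x fx _; rewrite gee0_abs.
have : \int[mu]_x `|f x| = 0.
  apply/eqP; rewrite eq_le integral_ge0// andbT.
  rewrite (le_trans _ If)//; apply: ae_le_integral => //.
    exact: measurableT_comp.
  by apply: filterS f_abs => x ->.
move/(ae_eq_integral_abs mu measurableT mf).
by apply: filterS => x; apply.
Qed.

(** The integrable minorant bounds the negative part, and an integral below [+oo] then forces the
    positive part to be finite too. *)
Lemma integrable_ge f g : measurable_fun setT f -> mu.-integrable setT g ->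
  {ae mu, forall x, g x <= f x} -> \int[mu]_x f x < +oo ->
  mu.-integrable setT f.
Proof.
move=> mf ig gf If.
have negf : \int[mu]_x f^\- x < +oo.
  apply: (le_lt_trans _ (integral_funeneg_lt_pinfty measurableT ig)).
  apply: ae_le_integral.
  - exact: measurable_funeneg.
  - exact/measurable_funeneg/(measurable_int _ ig).
  - apply: filterS gf => x gfx.
    by rewrite !funenegE ge_max !le_max leeN2 gfx lexx orbT.
have negf_fin : \int[mu]_x f^\- x \is a fin_num.
  by rewrite ge0_fin_numE// integral_ge0.
have posf : \int[mu]_x f^\+ x < +oo.
  move: If; rewrite integralE; move: negf_fin.
  case: (\int[mu]_x f^\- x) => // r _.
  by case: (\int[mu]_x f^\+ x) => //= s _; rewrite ltry.
apply/integrableP; split => //.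
rewrite -/(abse \o f) fune_abse ge0_integralD//; last 2 first.
- exact: measurable_funepos.
- exact: measurable_funeneg.
by rewrite lte_add_pinfty.
Qed.

(** If the right-hand side is finite or [-oo], the minorant [g + v] makes [u + v] integrable, hence
    also [u = (u + v) - v], and ordinary additivity applies. *)
Lemma integralD_ge (u v g : T -> K) : measurable_fun setT u ->
  mu.-integrable setT (EFin \o v) -> mu.-integrable setT (EFin \o g) ->
  {ae mu, forall x, (g x <= u x)%R} ->
  \int[mu]_x (u x)%:E + \int[mu]_x (v x)%:E <= \int[mu]_x (u x + v x)%:E.
Proof.
move=> mu_ iv ig gu.
have mv : measurable_fun setT v by exact/measurable_EFinP/(measurable_int mu).
have [uv|uv] := ltP (\int[mu]_x (u x + v x)%:E) +oo; last first.
  by move: uv; rewrite leye_eq => /eqP ->; rewrite leey.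
have iuv : mu.-integrable setT (EFin \o (fun x => u x + v x)%R).
  apply: (@integrable_ge _ (EFin \o (fun x => g x + v x)%R)) => //.
  - by apply/measurable_EFinP; exact: measurable_funD.
  - exact: (integrableD measurableT ig iv).
  - by apply: filterS gu => x gx; rewrite lee_fin lerD2r.
have iu : mu.-integrable setT (EFin \o u).
  apply: (eq_integrable measurableT _ _ _ (integrableB measurableT iuv iv)).
  by move=> x _ /=; rewrite -EFinB addrK.
by rewrite -[leLHS](integralD measurableT iu iv).
Qed.

End integral_lemmas.

(* On a nonnegative function the library's integral is the supremum of the
   integrals of the simple functions below it, measurable or not. *)
Section lower_integral.
Context d (T : measurableType d) (K : realType).
Import HBNNSimple.
Implicit Types (mu : {measure set T -> \bar K}) (F G : T -> \bar K).

Lemma ge0_le_lower_integral mu F G : (forall x, 0 <= F x) ->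
  (forall x, F x <= G x) -> \int[mu]_x F x <= \int[mu]_x G x.
Proof.
move=> F0 FG; have G0 x : 0 <= G x by exact: le_trans (FG x).
rewrite !ge0_integralTE//; apply: le_ereal_sup => _ /= [h hF <-].
by exists h => // x; exact: le_trans (FG x).
Qed.

Lemma lower_integral_leP mu F (c : \bar K) : (forall x, 0 <= F x) ->
  (forall h : {nnsfun T >-> K}, (forall x, (h x)%:E <= F x) ->
    \int[mu]_x (h x)%:E <= c) ->
  \int[mu]_x F x <= c.
Proof.
move=> F0 hc; rewrite ge0_integralTE//; apply: ge_ereal_sup => _ /= [h hF <-].
by rewrite -integralT_nnsfun; exact: hc.
Qed.

(** [F] may be nonmeasurable, so the almost-everywhere argument is applied to each simple function
    below it. *)
Lemma negligible_lower_integral mu (N : set T) F : measurable N -> mu N = 0 ->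
  (forall x, 0 <= F x) -> (forall x, ~ N x -> F x = 0) -> \int[mu]_x F x = 0.
Proof.
move=> mN N0 F0 FN; apply/eqP; rewrite eq_le integral_ge0// andbT.
apply: lower_integral_leP => // h hF.
rewrite (ae_eq_integral (cst 0)) ?integral0//.
- exact/measurable_EFinP.
- exists N; split => // x /= hx; apply: contrapT => Nx; apply: hx => _.
  apply/eqP; rewrite eq_le -[X in _ <= X](FN _ Nx) hF /=.
  by rewrite lee_fin.
Qed.

(** For each simple [h] below [F], the function [h + G] is integrable and lies almost everywhere
    below [F']; the supremum over [h] is taken after moving the finite integral of [G] to the
    right. *)
Lemma lower_integralD_le (mu : probability T K) F F' G :
  (forall x, 0 <= F x) -> (forall x, 0 <= F' x) ->
  mu.-integrable setT G -> {ae mu, forall x, F x + G x <= F' x} ->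
  \int[mu]_x F x + \int[mu]_x G x <= \int[mu]_x F' x.
Proof.
move=> F0 F'0 iG [N [mN N0 NFG]].
have Gfin := integrable_fin_num measurableT iG.
rewrite -leeBrDr//; apply: lower_integral_leP => // h hF.
rewrite leeBrDr//.
have ih : mu.-integrable setT (EFin \o h).
  apply: measurable_bounded_integrable => //.
    by rewrite [X in X < _]probability_setT ltry.
  exact: simple_bounded.
rewrite -(integralD measurableT ih iG).
have mhG : measurable_fun setT (fun x => (h x)%:E + G x).
  by apply: emeasurable_funD; [exact/measurable_EFinP|exact: measurable_int iG].
(* Cutting off at 0 and erasing the exceptional set gives a nonnegative function below [F']
   everywhere, as monotonicity of the lower integral requires. *)
pose phi := (fun x => maxe ((h x)%:E + G x) 0) \_ (~` N).
apply: (@le_trans _ _ (\int[mu]_x phi x)).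
  apply: ae_le_integral => //.
    apply/(measurable_restrictT _ _).1; first exact: measurableC.
    by apply: measurable_funTS; exact: measurable_maxe.
  exists N; split => // x /=; apply: contra_notP => Nx.
  by rewrite /phi patchE mem_set// le_max lexx.
apply: ge0_le_lower_integral => x; rewrite /phi patchE.
  by case: ifPn => // _; rewrite le_max lexx orbT.
case: ifPn => // /[!inE] Nx; rewrite ge_max F'0 andbT.
have : F x + G x <= F' x by apply: contrapT => ?; exact/Nx/NFG.
by apply: le_trans; rewrite leeD2r.
Qed.

(** Simple functions [h1] and [h2] nearly optimal for [mu1] and [mu2] are merged into their maximum,
    which is measurable, still below [F], and at least as good for both measures. The two suprema
    are then taken one after the other. *)
Lemma lower_integral_mixture (a b : K) (mu1 mu2 mu : {measure set T -> \bar K})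
    F : (0 < a)%R -> (0 < b)%R -> (forall x, 0 <= F x) ->
  (forall B, measurable B -> mu B = a%:E * mu1 B + b%:E * mu2 B) ->
  a%:E * \int[mu1]_x F x + b%:E * \int[mu2]_x F x <= \int[mu]_x F x.
Proof.
move=> a0 b0 F0 muE.
have a0' := ltW a0; have b0' := ltW b0.
pose na := NngNum a0'; pose nb := NngNum b0'.
have mufE f : measurable_fun setT f -> (forall x, 0 <= f x) ->
    \int[mu]_x f x = a%:E * \int[mu1]_x f x + b%:E * \int[mu2]_x f x.
  move=> mf f0.
  rewrite (eq_measure_integral (measure_add (mscale na mu1) (mscale nb mu2))).
    by rewrite ge0_integral_measure_add// !ge0_integral_mscale.
  by move=> B mB _; rewrite [RHS]measure_addE muE.
have sup_le (h1 h2 : {nnsfun T >-> K}) : (forall x, (h1 x)%:E <= F x) ->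
    (forall x, (h2 x)%:E <= F x) ->
    a%:E * \int[mu1]_x (h1 x)%:E + b%:E * \int[mu2]_x (h2 x)%:E <=
      \int[mu]_x F x.
  move=> h1F h2F.
  pose h : T -> \bar K := fun x => maxe (h1 x)%:E (h2 x)%:E.
  have mh : measurable_fun setT h.
    by apply: measurable_maxe; exact/measurable_EFinP.
  have h0 x : 0 <= h x by rewrite /h le_max lee_fin fun_ge0.
  apply: (@le_trans _ _ (\int[mu]_x h x)).
    rewrite mufE//; apply: leeD; rewrite lee_pmul2l// ge0_le_lower_integral//.
    - by move=> x; rewrite lee_fin.
    - by move=> x; rewrite /h le_max lexx.
    - by move=> x; rewrite lee_fin.
    - by move=> x; rewrite /h le_max lexx orbT.
  by apply: ge0_le_lower_integral => // x; rewrite /h ge_max h1F h2F.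
(* Isolating one supremum means subtracting the other term, which is finite once the right-hand side
   is. *)
have [Zfin|] := ltP (\int[mu]_x F x) +oo; last first.
  by rewrite leye_eq => /eqP ->; rewrite leey.
have fin_of x y : 0 <= x -> 0 <= y -> x + y <= \int[mu]_x F x ->
    x \is a fin_num.
  move=> x0 y0 xyZ; rewrite ge0_fin_numE// (le_lt_trans _ Zfin)//.
  by rewrite (le_trans _ xyZ)// leeDl.
have int_ge0 (m : {measure set T -> \bar K}) f (c : K) : (0 < c)%R ->
    (forall x, 0 <= f x) -> 0 <= c%:E * \int[m]_x f x.
  move=> c0 f0; apply: mule_ge0; first by rewrite lee_fin ltW.
  exact: integral_ge0.
have sup1 (h : {nnsfun T >-> K}) : (forall x, (h x)%:E <= F x) ->
    a%:E * \int[mu1]_x F x + b%:E * \int[mu2]_x (h x)%:E <= \int[mu]_x F x.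
  move=> hF; have bh0 := int_ge0 mu2 (fun x => (h x)%:E) b b0.
  have bhfin : b%:E * \int[mu2]_x (h x)%:E \is a fin_num.
    apply: (fin_of _ (a%:E * \int[mu1]_x (h x)%:E)).
    - by apply: bh0 => x; rewrite lee_fin.
    - by apply: int_ge0 => // x; rewrite lee_fin.
    - by rewrite addeC sup_le.
  rewrite -leeBrDr// -lee_pdivlMl//; apply: lower_integral_leP => // k kF.
  by rewrite lee_pdivlMl// leeBrDr// sup_le.
have aFfin : a%:E * \int[mu1]_x F x \is a fin_num.
  apply: (fin_of _ (b%:E * \int[mu2]_x (@nnsfun0 _ T K x)%:E)).
  - exact: int_ge0.
  - by apply: int_ge0 => // x; rewrite lee_fin.
  - by apply: sup1 => x; exact: F0.
rewrite -leeBrDl// -lee_pdivlMl//; apply: lower_integral_leP => // k kF.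
by rewrite lee_pdivlMl// leeBrDl// sup1.
Qed.

End lower_integral.

(** * Densities of dominated probability measures *)

Section densities.
Context d (T : measurableType d) (K : realType).
Implicit Types nu mu : probability T K.

Lemma null_dominates_ae nu mu (P : T -> Prop) :
  nu `<< mu -> {ae mu, forall y, P y} -> {ae nu, forall y, P y}.
Proof.
move=> /null_content_dominatesP numu [N [mN N0 PN]].
by exists N; split => //; exact: numu.
Qed.

Section density.
Context nu mu (numu : nu `<< mu).
Let f := density nu mu.

Lemma density_fin_num y : f y \is a fin_num.
Proof. exact: Radon_Nikodym_fin_num. Qed.

Lemma density_integrable : mu.-integrable setT f.
Proof. exact: Radon_Nikodym_integrable. Qed.

Lemma measurable_density : measurable_fun setT f.
Proof. exact: measurable_int density_integrable. Qed.

Lemma measurable_fine_density : measurable_fun setT (fun y => fine (f y)).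
Proof.
apply: measurableT_comp measurable_density.
exact: (@fine_measurable K setT measurableT).
Qed.

Lemma integral_density A : measurable A -> nu A = \int[mu]_(y in A) f y.
Proof.
exact: (@Radon_Nikodym_integral _ _ _ (charge_of_finite_measure nu)).
Qed.

(** The change of variables is available for the sigma-finite form of the derivative, which agrees
    [mu]-almost everywhere with [f]. *)
Lemma ge0_integral_density (g : T -> \bar K) : measurable_fun setT g ->
  (forall y, 0 <= g y) -> \int[nu]_y g y = \int[mu]_y (g y * f y).
Proof.
move=> mg g0; rewrite -(Radon_Nikodym_SigmaFinite.change_of_variables numu)//.
apply: ae_eq_integral => //.
- apply: emeasurable_funM => //.
  exact: measurable_int (Radon_Nikodym_SigmaFinite.f_integrable numu).
- by apply: emeasurable_funM => //; exact: measurable_density.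
- exact/ae_eqe_mul2l/ae_eq_Radon_Nikodym_SigmaFinite.
Qed.

Lemma density_ge0 : {ae mu, forall y, 0 <= f y}.
Proof.
apply: filterS (ae_eq_Radon_Nikodym_SigmaFinite numu measurableT) => y.
move=> /(_ I); rewrite /f /density => <-.
exact: Radon_Nikodym_SigmaFinite.f_ge0.
Qed.

(** The [nu]-measure of the set where [f <= 0] is the [mu]-integral of [f] over it, hence at most 0.
    Values of [ln] outside the positive reals are therefore harmless under [nu]. *)
Lemma density_gt0 : {ae nu, forall y, (0 < fine (f y))%R}.
Proof.
pose A := [set y | f y <= 0].
have mA : measurable A.
  rewrite -[A]setTI; apply: emeasurable_fun_infty_c => //.
  exact: measurable_density.
exists A; split => //.
  apply/eqP; rewrite -measure_le0 [leLHS]integral_density// integral_mkcond.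
  apply: (@le_trans _ _ (\int[mu]_y cst 0 y)); last by rewrite integral0.
  apply: ae_le_integral => //.
    apply/(measurable_restrictT _ _).1 => //.
    exact/measurable_funTS/measurable_density.
  by apply: aeW => y; rewrite patchE; case: ifPn => // /[!inE].
move=> y /=; rewrite -lte_fin fineK ?density_fin_num// => /negP.
by rewrite -leNgt.
Qed.

End density.

End densities.

(** * Relative entropy: nonnegativity, equality case and chain rule *)

Section relative_entropy.
Context d (T : measurableType d) (K : realType).
Implicit Types nu mu p m : probability T K.

(** The tangent inequality [1 + t <= expR t] at [t = - ln x]; its strict form for nonzero [t] gives
    the equality case that follows. *)
Lemma ge_ln1BV (x : K) : (0 < x)%R -> (1 - x^-1 <= ln x)%R.
Proof.
move=> x0; have := @expR_ge1Dx K (- ln x)%R.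
by rewrite expRN lnK ?posrE// lerBlDr addrC -lerBlDr.
Qed.

Lemma ln_eq1BV (x : K) : (0 < x)%R -> ln x = (1 - x^-1)%R -> x = 1%R.
Proof.
move=> x0 lnx; apply/eqP; rewrite -ln_eq0//; apply: contrapT => /negP lnx0.
have := @expR_gt1Dx K (- ln x)%R; rewrite oppr_eq0 => /(_ lnx0).
by rewrite expRN lnK ?posrE// lnx opprB addrC subrK ltxx.
Qed.

Let ln2_gt0 : (0 < ln (2 : K))%R.
Proof. by rewrite ln_gt0// ltr1n. Qed.

Definition log_density nu mu (y : T) : K :=
  (ln (fine (density nu mu y)) / ln 2)%R.

Section dominated.
Context nu mu (numu : nu `<< mu).

Let r (y : T) := fine (density nu mu y).

Let mr : measurable_fun setT r.
Proof. exact: measurable_fine_density. Qed.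

Lemma measurable_log_density : measurable_fun setT (log_density nu mu).
Proof.
apply: measurable_funM => //.
exact: measurableT_comp (@measurable_ln K) mr.
Qed.

Lemma relative_entropyE :
  relative_entropy nu mu = \int[nu]_y (log_density nu mu y)%:E.
Proof. by rewrite /relative_entropy asboolT. Qed.

(* This is [(r y)^-1] wherever [0 < r y], but nonnegative and visibly measurable
   everywhere. *)
Let q (y : T) : K := expR (- ln (r y)).

Let qE y : (0 < r y)%R -> q y = (r y)^-1%R.
Proof. by move=> r0; rewrite /q expRN lnK. Qed.

Let mq : measurable_fun setT q.
Proof.
apply: measurableT_comp => //; apply: measurableT_comp => //.
exact: measurableT_comp (@measurable_ln K) mr.
Qed.

(** Passing to [mu] turns the integrand into [q * r], which is 1 where [r > 0] and 0 where
    [r = 0]. *)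
Let q_le1 : \int[nu]_y (q y)%:E <= 1.
Proof.
rewrite (ge0_integral_density numu); last 2 first.
- exact/measurable_EFinP.
- by move=> y; rewrite lee_fin expR_ge0.
apply: (@le_trans _ _ (\int[mu]_y cst 1 y)); last first.
  by rewrite integral_cst// mul1e [X in X <= _]probability_setT.
apply: ae_le_integral => //.
  apply: emeasurable_funM; first exact/measurable_EFinP.
  exact: measurable_density.
apply: filterS (density_ge0 numu) => y f0.
rewrite -(fineK (density_fin_num numu y)) -/(r y) -EFinM lee_fin.
have : (0 <= r y)%R by rewrite -lee_fin fineK// density_fin_num.
rewrite le_eqVlt => /predU1P[<-|r0]; first by rewrite mulr0.
by rewrite qE// mulVf// gt_eqF.
Qed.

Let iq : nu.-integrable setT (EFin \o q).
Proof.
apply/integrableP; split; first exact/measurable_EFinP.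
apply: (@le_lt_trans _ _ (\int[nu]_y (q y)%:E)).
  by apply: ge0_le_lower_integral => // y /=; rewrite ger0_norm// expR_ge0.
by rewrite (le_lt_trans q_le1)// ltry.
Qed.

(** The tangent minorant of [log_density]: it is integrable, and its integral [(1 - \int q) / ln 2]
    is nonnegative, which yields Gibbs' inequality. *)
Let g (y : T) : K := ((1 - q y) / ln 2)%R.

Let i1q : nu.-integrable setT (fun y => 1 - (q y)%:E).
Proof.
apply: (integrableB measurableT _ iq).
exact: finite_measure_integrable_cst.
Qed.

Let ig : nu.-integrable setT (EFin \o g).
Proof.
have := integrableZl measurableT (ln 2)^-1 i1q.
apply: eq_integrable => //.
by move=> y _ /=; rewrite -EFinB -EFinM mulrC.
Qed.

Let g_ge0 : 0 <= \int[nu]_y (g y)%:E.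
Proof.
rewrite (eq_integral (fun y => (ln 2)^-1%:E * (1 - (q y)%:E))); last first.
  by move=> y _ /=; rewrite -EFinB -EFinM mulrC.
rewrite (integralZl measurableT i1q) mule_ge0//.
  by rewrite lee_fin invr_ge0 ltW.
have i1 : nu.-integrable setT (cst (1 : \bar K)).
  exact: finite_measure_integrable_cst.
rewrite (integralB measurableT i1 iq) integral_cst// mul1e.
rewrite [X in X - _]probability_setT sube_ge0//.
by rewrite (integrable_fin_num measurableT iq) orbT.
Qed.

Let g_le_log_density : {ae nu, forall y, (g y <= log_density nu mu y)%R}.
Proof.
apply: filterS (density_gt0 numu) => y r0.
by rewrite /g qE// ler_pM2r ?invr_gt0// ge_ln1BV.
Qed.

Lemma log_density_integrable : relative_entropy nu mu < +oo ->
  nu.-integrable setT (EFin \o log_density nu mu).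
Proof.
rewrite relative_entropyE => Dfin.
apply: (integrable_ge _ ig) => //.
exact/measurable_EFinP/measurable_log_density.
Qed.

(** Supplies the integrable minorant for the chain rule, where the divergence itself may be
    infinite. *)
Lemma log_density_lower_bound :
  exists2 g : T -> K, nu.-integrable setT (EFin \o g) &
  {ae nu, forall y, (g y <= log_density nu mu y)%R}.
Proof. by exists g. Qed.

Lemma relative_entropy_ge0_dominated : 0 <= relative_entropy nu mu.
Proof.
rewrite relative_entropyE (le_trans g_ge0)//; apply: ae_le_integral.
- exact: measurable_int ig.
- exact/measurable_EFinP/measurable_log_density.
- by apply: filterS g_le_log_density => y; rewrite lee_fin.
Qed.

(** The difference [log_density - g] is nonnegative with integral at most 0, so it vanishes almost
    everywhere; equality in the tangent inequality then forces [r = 1]. *)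
Let density1_dominated : relative_entropy nu mu <= 0 ->
  {ae nu, forall y, r y = 1%R}.
Proof.
move=> D0; have il : nu.-integrable setT (EFin \o log_density nu mu).
  by apply: log_density_integrable; rewrite (le_lt_trans D0).
have : {ae nu, forall y, (log_density nu mu y)%:E - (g y)%:E = 0}.
  apply: ge0_integral_le0_ae.
  - exact: measurable_int (integrableB measurableT il ig).
  - by apply: filterS g_le_log_density => y; rewrite -EFinB lee_fin subr_ge0.
  - rewrite (integralB measurableT il ig) -relative_entropyE.
    by rewrite leeBlDr ?add0e ?(le_trans D0)// integrable_fin_num.
apply: filterS2 (density_gt0 numu) => y r0 /eqP.
rewrite -EFinB eqe subr_eq0 /log_density /g -/(r y) qE//.
move=> /eqP/mulIf; rewrite invr_neq0 ?gt_eqF// => /(_ isT).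
exact: ln_eq1BV.
Qed.

Let le_of_density1 : relative_entropy nu mu <= 0 ->
  forall B, measurable B -> nu B <= mu B.
Proof.
move=> /density1_dominated r1 B mB.
pose A := [set y | r y = 1%R].
have mA : measurable A.
  by have := mr measurableT (measurable_set1 (1%R : K)); rewrite setTI.
have nuA : nu (~` A) = 0.
  have [N [mN N0 AN]] := r1; apply/eqP; rewrite -measure_le0 -[leRHS]N0.
  by rewrite le_measure// inE//; exact: measurableC.
have mBA : measurable (B `&` A) by exact: measurableI.
have nuBA : nu (B `\` A) = 0.
  apply/eqP; rewrite -measure_le0 -[leRHS]nuA le_measure ?inE//.
  - exact: measurableD.
  - exact: measurableC.
have -> : nu B = nu (B `\` A) + nu (B `&` A) by exact: measureDI.
rewrite nuBA add0e [leLHS](integral_density numu mBA).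
rewrite (eq_integral (cst 1)); last first.
  move=> y /[!inE] -[_ ry].
  by rewrite -(fineK (density_fin_num numu y)) -/(r y) ry.
by rewrite integral_cst// mul1e le_measure ?inE//; exact: subIsetl.
Qed.

(** [nu] is carried by the set where [r = 1], which gives [nu <= mu]; for probability measures the
    same bound on complements gives the converse. *)
Lemma relative_entropy_le0_eq : relative_entropy nu mu <= 0 ->
  forall B, measurable B -> nu B = mu B.
Proof.
move=> D0 B mB; apply/eqP; rewrite eq_le le_of_density1//=.
have := le_of_density1 D0 (measurableC mB).
have nuB : nu B \is a fin_num by exact: fin_num_measure.
have muB : mu B \is a fin_num by exact: fin_num_measure.
rewrite !probability_setC// -(fineK nuB) -(fineK muB) -!EFinB !lee_fin.
by rewrite lerD2l lerN2.
Qed.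

End dominated.

Lemma relative_entropy_ge0 nu mu : 0 <= relative_entropy nu mu.
Proof.
have [numu|numu] := pselect (nu `<< mu).
  exact: relative_entropy_ge0_dominated.
by rewrite /relative_entropy asboolF.
Qed.

(* Equality holds, by the chain rule for densities; the two sides may be
   infinite. *)
Lemma relative_entropy_chain nu p m : nu `<< p -> p `<< m ->
  nu.-integrable setT (EFin \o log_density p m) ->
  relative_entropy nu p + \int[nu]_y (log_density p m y)%:E <=
  relative_entropy nu m.
Proof.
move=> nup pm ipm; have num : nu `<< m by exact: null_dominates_trans pm.
have [g ig gle] := log_density_lower_bound nup.
rewrite !relative_entropyE//.
apply: (le_trans (integralD_ge (measurable_log_density nup) ipm ig gle)).
apply: ae_le_integral.
- apply/measurable_EFinP/measurable_funD; exact: measurable_log_density.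
- exact/measurable_EFinP/measurable_log_density.
(* The product formula holds [m]-almost everywhere and is transported to [nu]; there all three
   densities are positive, so [ln] turns the product into a sum. *)
have chain := @Radon_Nikodym_chain_rule _ _ _
  (charge_of_finite_measure nu) m p nup pm.
have pm_gt0 := null_dominates_ae nup (density_gt0 pm).
have nup_gt0 := density_gt0 nup.
have num_gt0 := density_gt0 num.
have {chain} chain := null_dominates_ae num chain.
apply: filterS2 (filterI pm_gt0 nup_gt0) (filterI num_gt0 chain).
move=> y [pm0 nup0] [num0 /(_ I) E].
rewrite lee_fin /log_density -mulrDl ler_pM2r ?invr_gt0//.
rewrite (_ : density nu m y = density nu p y * density p m y)//.
by rewrite fineM ?density_fin_num// lnM ?posrE.
Qed.

End relative_entropy.

(** * Domination, and finiteness of the divergence of a component from its mixture *)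

Section domination.
Context d (T : measurableType d) (K : realType).
Implicit Types nu p m : probability T K.

(** If [p A = 0], the density of [p] integrates to 0 over [A], so the part of [A] where it is
    positive is [m]-null, hence [nu]-null; the rest of [A] is [nu]-null by the positivity
    assumption. *)
Lemma density_gt0_null_dominates nu p m : nu `<< m -> p `<< m ->
  {ae nu, forall y, (0 < fine (density p m y))%R} -> nu `<< p.
Proof.
move=> num pm gt0; apply/null_content_dominatesP => A mA pA.
pose D := [set y | 0 < density p m y].
have mD : measurable D.
  have := emeasurable_fun_o_infty measurableT (measurable_density pm) 0.
  by rewrite setTI.
have mAD : measurable (A `&` D) by exact: measurableI.
have nuAD : nu (A `\` D) = 0.
  have [N [mN N0 DN]] := gt0; apply/eqP; rewrite -measure_le0 -[leRHS]N0.
  rewrite le_measure ?inE//; first exact: measurableD.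
  move=> y [_ Dy]; apply: DN => /= yp; apply: Dy.
  by rewrite /D /= -(fineK (density_fin_num pm y)) lte_fin.
have mAD0 : m (A `&` D) = 0.
  pose f := density p m \_ (A `&` D).
  have mf : measurable_fun setT f.
    apply/(measurable_restrictT _ _).1 => //.
    exact/measurable_funTS/measurable_density.
  have f0 y : 0 <= f y.
    by rewrite /f patchE; case: ifPn => // /[!inE] -[_ /ltW].
  have If : \int[m]_y f y <= 0.
    rewrite -integral_mkcond -integral_density// -pA le_measure ?inE//.
  have [N [mN N0 fN]] := ge0_integral_le0_ae mf (aeW m f0) If.
  apply/eqP; rewrite -measure_le0 -[leRHS]N0 le_measure ?inE// => y ADy.
  apply: fN => /=; rewrite /f patchE mem_set// => y0.
  by case: ADy => _; rewrite /D /= y0 ltxx.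
have -> : nu A = nu (A `\` D) + nu (A `&` D) by exact: measureDI.
by rewrite nuAD add0e; move/null_content_dominatesP : num; exact.
Qed.

Section scaled.
Context p m (c : K) (c0 : (0 < c)%R).
Hypothesis cpm : forall B, measurable B -> c%:E * p B <= m B.

Lemma scaled_null_dominates : p `<< m.
Proof.
apply/null_content_dominatesP => A mA mA0; apply/eqP.
rewrite -measure_le0 -(mule0 c^-1%:E) lee_pdivlMl// -mA0.
exact: cpm.
Qed.

(** On the set [A] where the density exceeds [c^-1], the excess is positive but integrates to
    [p A - c^-1 * m A <= 0], so [A] is null. *)
Lemma density_le_inv : {ae p, forall y, (fine (density p m y) <= c^-1)%R}.
Proof.
have pm := scaled_null_dominates.
pose A := [set y | c^-1%:E < density p m y].
have mA : measurable A.
  have := emeasurable_fun_o_infty measurableT (measurable_density pm) c^-1%:E.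
  by rewrite setTI.
have i1 : m.-integrable A (density p m).
  by apply: (integrableS measurableT) => //; exact: density_integrable.
have i2 : m.-integrable A (cst c^-1%:E) by exact: finite_measure_integrable_cst.
pose f := (fun y => density p m y - c^-1%:E) \_ A.
have mf : measurable_fun setT f.
  apply/(measurable_restrictT _ _).1 => //.
  by apply: measurable_int (integrableB _ i1 i2).
have f0 y : 0 <= f y.
  rewrite /f patchE; case: ifPn => // /[!inE] /ltW yA.
  by rewrite sube_ge0.
have If : \int[m]_y f y <= 0.
  rewrite -integral_mkcond (integralB mA i1 i2) -integral_density//.
  rewrite integral_cst// leeBlDr ?add0e ?lee_pdivlMl//; last first.
    by rewrite fin_numM// fin_num_measure.
  exact: cpm.
have [N [mN N0 fN]] := ge0_integral_le0_ae mf (aeW m f0) If.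
exists A; split => //.
  have /null_content_dominatesP := pm; apply => //.
  apply/eqP; rewrite -measure_le0 -[leRHS]N0 le_measure ?inE// => y Ay.
  apply: fN => /=; rewrite /f patchE mem_set// => y0.
  by move: Ay; rewrite /A /= -sube_gt0 y0 ltxx.
move=> y /= /negP; rewrite -ltNge -lte_fin.
by rewrite fineK ?density_fin_num.
Qed.

Lemma relative_entropy_scaled_lty : relative_entropy p m < +oo.
Proof.
have pm := scaled_null_dominates.
rewrite relative_entropyE//.
apply: (@le_lt_trans _ _ (\int[p]_y cst (ln c^-1 / ln 2)%:E y)); last first.
  by rewrite integral_cst// [X in _ * X]probability_setT mule1 ltry.
apply: ae_le_integral => //.
  exact/measurable_EFinP/measurable_log_density.
apply: filterS2 density_le_inv (density_gt0 pm) => y yc y0.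
rewrite lee_fin ler_pM2r ?invr_gt0 ?ln_gt0 ?ltr1n//.
by rewrite ler_ln ?posrE ?invr_gt0.
Qed.

End scaled.

End domination.

(** * Averaging a kernel, and the compensation inequality *)

Section averaged_kernel.
Context dX dY (X : measurableType dX) (Y : measurableType dY) (K : realType).
Variables (P : probability X K) (k : X -> probability Y K).
Variable p : probability Y K.
Hypothesis mk : forall B, measurable B -> measurable_fun setT (fun x => k x B).
Hypothesis pE : forall B, measurable B -> p B = \int[P]_x k x B.

Lemma measurable_integral_kernel (f : Y -> \bar K) : measurable_fun setT f ->
  (forall y, 0 <= f y) -> measurable_fun setT (fun x => \int[k x]_y f y).
Proof.
move=> mf f0.
exact: (@measurable_fun_integral_kernel _ _ X Y K (fun x => k x) mk f f0 mf).
Qed.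

(** On measurable sets [p] is the bind of [P] along [k] in the Giry monad, whose integration formula
    gives the equation. *)
Lemma ge0_integral_average (f : Y -> \bar K) : measurable_fun setT f ->
  (forall y, 0 <= f y) -> \int[p]_y f y = \int[P]_x \int[k x]_y f y.
Proof.
move=> mf f0.
pose k' (x : X) : giry Y K := k x.
have mk' : measurable_fun setT k' by apply: measurable_giry_codensity.
have := giry_int_bind (P : giry X K) mk' mf f0.
rewrite /giry_int => <-; apply: eq_measure_integral => B mB _.
apply: (etrans (pE mB)); rewrite /giry_bind /=.
by rewrite [RHS]giry_int_map//; exact: measurable_giry_ev.
Qed.

(** For a [p]-null set [N], the nonnegative function [x |-> k x N] has [P]-integral 0. *)
Lemma ae_average (Q : Y -> Prop) :
  {ae p, forall y, Q y} -> {ae P, forall x, {ae k x, forall y, Q y}}.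
Proof.
move=> [N [mN N0 QN]].
have : ae_eq P setT (fun x => k x N) (cst 0).
  apply/ae_eq_integral_abs => //; first exact: mk.
  under eq_integral do rewrite gee0_abs//.
  by rewrite -pE.
by apply: filterS => x /(_ I) kN; exists N.
Qed.

Section integrable.
Variable f : Y -> \bar K.
Hypothesis ifp : p.-integrable setT f.

Let mf : measurable_fun setT f := measurable_int _ ifp.

Let integrable_part (g : Y -> \bar K) : (forall y, 0 <= g y) ->
  p.-integrable setT g -> P.-integrable setT (fun x => \int[k x]_y g y).
Proof.
move=> g0 /integrableP[mg ig]; apply/integrableP; split.
  exact: measurable_integral_kernel.
under eq_integral do rewrite gee0_abs ?integral_ge0//.
rewrite -ge0_integral_average//; move: ig.
by under eq_integral do rewrite gee0_abs//.
Qed.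

Let ipos : P.-integrable setT (fun x => \int[k x]_y f^\+ y).
Proof. by apply: integrable_part => //; exact: integrable_funepos. Qed.

Let ineg : P.-integrable setT (fun x => \int[k x]_y f^\- y).
Proof. by apply: integrable_part => //; exact: integrable_funeneg. Qed.

Lemma integrable_integral_average :
  P.-integrable setT (fun x => \int[k x]_y f y).
Proof.
apply: (eq_integrable measurableT _ _ _ (integrableB measurableT ipos ineg)).
by move=> x _; rewrite [RHS]integralE.
Qed.

Lemma integral_average : \int[P]_x \int[k x]_y f y = \int[p]_y f y.
Proof.
under eq_integral do rewrite integralE.
rewrite (integralB measurableT ipos ineg) [RHS]integralE.
rewrite !ge0_integral_average//; first exact: measurable_funeneg.
exact: measurable_funepos.
Qed.

Lemma ae_integrable_average : {ae P, forall x, (k x).-integrable setT f}.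
Proof.
have iabs : p.-integrable setT (abse \o f) by exact: integrable_abse.
have iabs_k := integrable_part (fun y => abse_ge0 (f y)) iabs.
have := integrable_ae measurableT iabs_k.
apply: filterS => x /(_ I) fin; apply/integrableP; split => //.
by move: fin; rewrite ge0_fin_numE// integral_ge0.
Qed.

End integrable.

(* For almost every [x] either [k x] is not dominated by [m], and the right-hand
   integrand is infinite, or [k x `<< p] and the chain rule applies. *)
Lemma compensation_le (m : probability Y K) : p `<< m ->
  relative_entropy p m < +oo ->
  \int[P]_x relative_entropy (k x) p + relative_entropy p m <=
  \int[P]_x relative_entropy (k x) m.
Proof.
move=> pm Dfin; have il := log_density_integrable pm Dfin.
(* The divergence of [p] from [m] becomes the [P]-integral of an integrable function of [x], so it
   can be added to a lower integral and compared pointwise. *)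
rewrite (relative_entropyE pm) -(integral_average il).
apply: lower_integralD_le.
- by move=> x; exact: relative_entropy_ge0.
- by move=> x; exact: relative_entropy_ge0.
- exact: integrable_integral_average.
apply: filterS2 (ae_integrable_average il) (ae_average (density_gt0 pm)).
move=> x ix x0.
have [kxm|kxm] := pselect (k x `<< m); last first.
  by rewrite [leRHS]/relative_entropy asboolF// leey.
apply: relative_entropy_chain => //.
exact: density_gt0_null_dominates kxm pm x0.
Qed.

End averaged_kernel.

(** The two densities have the same integral over every measurable set, so they agree [mu]-almost
    everywhere. The set where they differ is shown measurable so that monotonicity of [mu]
    applies. *)
Lemma density_ae_unique d (T : measurableType d) (K : realType)
    (nu1 nu2 mu : probability T K) : nu1 `<< mu -> nu2 `<< mu ->
  (forall B, measurable B -> nu1 B = nu2 B) ->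
  mu [set y | density nu1 mu y <> density nu2 mu y /\
    density nu2 mu y <> 0] = 0.
Proof.
move=> nu1mu nu2mu nu12.
have m1 := measurable_density nu1mu; have m2 := measurable_density nu2mu.
have [N [mN N0 fN]] : ae_eq mu setT (density nu1 mu) (density nu2 mu).
  apply: integral_ae_eq => //; first exact: density_integrable.
  move=> B _ mB; rewrite -(integral_density nu1mu mB).
  by rewrite -(integral_density nu2mu mB) nu12.
apply/eqP; rewrite -measure_le0 -[leRHS]N0 le_measure ?inE//.
  rewrite (_ : [set y | _] =
      [set y | density nu1 mu y != density nu2 mu y] `&`
      [set y | density nu2 mu y != 0]).
    apply: measurableI.
      by rewrite -[X in measurable X]setTI; exact: measurable_neqe.
    by rewrite -[X in measurable X]setTI; exact: emeasurable_neq.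
  apply/seteqP; split=> y /= [].
    by move=> /eqP ? /eqP.
  by move=> /eqP ? /eqP.
by move=> y [fy _]; apply: fN => /= /(_ I).
Qed.

(** * Concavity of the information at fixed side information *)

Section channel_mixture.
Context dX dY dS dV (X : measurableType dX) (Y : measurableType dY)
  (S : measurableType dS) (V : measurableType dV) (K : realType).
Variables (W : K.-pker (X * S) ~> Y) (Q : K.-pker V ~> S).
Variables (a : {i01 K}) (P1 P2 : probability X K).
Hypothesis a01 : (0 < a%:num < 1)%R.

Let a_gt0 : (0 < a%:num)%R. Proof. by case/andP : a01. Qed.

Let b_gt0 : (0 < 1 - a%:num)%R.
Proof. by case/andP : a01 => _; rewrite subr_gt0. Qed.

Let M : probability X K := mixture a P1 P2.

Lemma output_mixture v B : measurable B -> output_law W Q M v B =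
  (a%:num)%:E * output_law W Q P1 v B + (1 - a%:num)%:E * output_law W Q P2 v B.
Proof.
move=> mB; have mc := measurable_channel W Q v mB.
pose na := NngNum (ltW a_gt0); pose nb := NngNum (ltW b_gt0).
rewrite /output_law /= /output.
rewrite [LHS](eq_measure_integral (measure_add (mscale na P1) (mscale nb P2))).
  by rewrite ge0_integral_measure_add// !ge0_integral_mscale.
by move=> A mA _; rewrite [RHS]measure_addE.
Qed.

Lemma scaled_output_le_l v B : measurable B ->
  (a%:num)%:E * output_law W Q P1 v B <= output_law W Q M v B.
Proof.
move=> mB; rewrite (output_mixture v mB).
by apply: leeDl; rewrite mule_ge0// lee_fin ltW.
Qed.

Lemma scaled_output_le_r v B : measurable B ->
  (1 - a%:num)%:E * output_law W Q P2 v B <= output_law W Q M v B.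
Proof.
move=> mB; rewrite (output_mixture v mB).
by apply: leeDr; rewrite mule_ge0// lee_fin ltW.
Qed.

Lemma output_dominated_l v : output_law W Q P1 v `<< output_law W Q M v.
Proof. exact: (scaled_null_dominates a_gt0 (@scaled_output_le_l v)). Qed.

Lemma output_dominated_r v : output_law W Q P2 v `<< output_law W Q M v.
Proof. exact: (scaled_null_dominates b_gt0 (@scaled_output_le_r v)). Qed.

Lemma state_information_ge0 (P : probability X K) v :
  0 <= state_information W Q P v.
Proof. by apply: integral_ge0 => x _; exact: relative_entropy_ge0. Qed.

(** Both compensation inequalities use the reference measure [m], so their right-hand sides
    integrate one function against [P1] and [P2], and these integrals combine along the mixture. *)
Lemma state_information_mixture v :
  (a%:num)%:E * (state_information W Q P1 v +
    relative_entropy (output_law W Q P1 v) (output_law W Q M v)) +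
  (1 - a%:num)%:E * (state_information W Q P2 v +
    relative_entropy (output_law W Q P2 v) (output_law W Q M v)) <=
  state_information W Q M v.
Proof.
set m := output_law W Q M v.
have key (P : probability X K) (c : K) : (0 < c)%R ->
    (forall B, measurable B -> c%:E * output_law W Q P v B <= m B) ->
    state_information W Q P v + relative_entropy (output_law W Q P v) m <=
    \int[P]_x relative_entropy (channel W Q v x) m.
  move=> c0 cPm; apply: compensation_le => //.
  - by move=> B mB; exact: measurable_channel.
  - exact: scaled_null_dominates c0 cPm.
  - exact: relative_entropy_scaled_lty c0 cPm.
apply: le_trans (lower_integral_mixture a_gt0 b_gt0 _ _).
- apply: leeD; rewrite lee_pmul2l//.
  + exact: key a_gt0 (@scaled_output_le_l v).
  + exact: key b_gt0 (@scaled_output_le_r v).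
- by move=> x; exact: relative_entropy_ge0.
- by [].
Qed.

End channel_mixture.

(** * Equality in concavity forces equal outputs *)

Section equality_case.
Context dX dY dS dV (X : measurableType dX) (Y : measurableType dY)
  (S : measurableType dS) (V : measurableType dV) (K : realType).
Variables (W : K.-pker (X * S) ~> Y) (Q : K.-pker V ~> S) (R : probability V K).
Variables (a : {i01 K}) (P1 P2 : probability X K).
Hypothesis a01 : (0 < a%:num < 1)%R.

Let M : probability X K := mixture a P1 P2.

(** The concavity gap dominates the weighted divergences almost everywhere and has integral at most
    0, so both vanish. Only the gap is integrated over [v]; the divergences are compared with it
    pointwise. *)
Lemma ae_eq_output_law : real_valued_information W Q R P1 ->
  real_valued_information W Q R P2 -> real_valued_information W Q R M ->
  mutual_information W Q R M <= (a%:num)%:E * mutual_information W Q R P1 +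
    (1 - a%:num)%:E * mutual_information W Q R P2 ->
  {ae R, forall v, forall B, measurable B ->
    output_law W Q P1 v B = output_law W Q P2 v B}.
Proof.
move=> i1 i2 iM IM.
have [a_gt0 b_gt0] : (0 < a%:num)%R /\ (0 < 1 - a%:num)%R.
  by case/andP: a01 => a0 a1; rewrite subr_gt0.
pose D (P : probability X K) v :=
  relative_entropy (output_law W Q P v) (output_law W Q M v).
have D0 P v : 0 <= D P v by exact: relative_entropy_ge0.
have ia1 := integrableZl measurableT a%:num i1.
have ib2 := integrableZl measurableT (1 - a%:num)%R i2.
have i12 := integrableD measurableT ia1 ib2.
have igap := integrableB measurableT iM i12.
have fin12 := integrable_ae measurableT i12.
have gap_ge : {ae R, forall v,
    (a%:num)%:E * D P1 v + (1 - a%:num)%:E * D P2 v <=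
    state_information W Q M v - ((a%:num)%:E * state_information W Q P1 v +
      (1 - a%:num)%:E * state_information W Q P2 v)}.
  (* The subtraction can be undone only where the weighted information is finite, which holds for
     almost every [v] by integrability. *)
  apply: filterS fin12 => v /(_ I) fin; rewrite (leeBrDr _ _ fin).
  apply: le_trans (state_information_mixture W Q P1 P2 a01 v).
  rewrite (ge0_muleDr _ (state_information_ge0 W Q P1 v) (D0 P1 v)).
  rewrite (ge0_muleDr _ (state_information_ge0 W Q P2 v) (D0 P2 v)).
  by rewrite addeC addeACA.
have gap0 : {ae R, forall v, state_information W Q M v -
    ((a%:num)%:E * state_information W Q P1 v +
      (1 - a%:num)%:E * state_information W Q P2 v) = 0}.
  apply: ge0_integral_le0_ae; first exact: measurable_int igap.
    apply: filterS gap_ge => v; apply: le_trans.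
    by rewrite adde_ge0// mule_ge0// lee_fin ltW.
  rewrite (integralB measurableT iM i12) (integralD measurableT ia1 ib2).
  rewrite !integralZl// leeBlDr ?add0e//.
  by rewrite fin_numD !fin_numM//; exact: integrable_fin_num.
apply: filterS2 gap_ge gap0 => v + E; rewrite E => DD B mB.
have aD0 : 0 <= (a%:num)%:E * D P1 v by rewrite mule_ge0// lee_fin ltW.
have bD0 : 0 <= (1 - a%:num)%:E * D P2 v by rewrite mule_ge0// lee_fin ltW.
have D1 : D P1 v <= 0.
  rewrite -(lee_pmul2l (x := (a%:num)%:E))// mule0.
  by rewrite (le_trans _ DD)// leeDl.
have D2 : D P2 v <= 0.
  rewrite -(lee_pmul2l (x := (1 - a%:num)%:E))// mule0.
  by rewrite (le_trans _ DD)// leeDr.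
have dom1 : output_law W Q P1 v `<< output_law W Q M v.
  exact: output_dominated_l.
have dom2 : output_law W Q P2 v `<< output_law W Q M v.
  exact: output_dominated_r.
rewrite (relative_entropy_le0_eq dom1 D1 mB).
by rewrite (relative_entropy_le0_eq dom2 D2 mB).
Qed.

(** For [v] off a null set, the section of the set at [v] is [T v]-null. The integral over [v] is
    treated as a lower integral, so measurability of the sections' measure in [v] does not enter. *)
Lemma family_product_densities_differ0 (T : V -> probability Y K) :
  (forall v, output_law W Q M v `<< T v) ->
  {ae R, forall v, forall B, measurable B ->
    output_law W Q P1 v B = output_law W Q P2 v B} ->
  family_product T R
    (densities_differ (output_law W Q P1) (output_law W Q P2) T) = 0.
Proof.
move=> MT [N [mN N0 eqN]].
apply: (negligible_lower_integral mN N0) => [v|v Nv]; first exact: measure_ge0.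
apply: density_ae_unique.
- by apply: null_dominates_trans (MT v); exact: output_dominated_l.
- by apply: null_dominates_trans (MT v); exact: output_dominated_r.
- by apply: contrapT => eqv; exact/Nv/eqN.
Qed.

End equality_case.

(** * Uniqueness of the capacity-achieving input *)

Unset Implicit Arguments.
Theorem proposition4p2 (K : realType) (X Y S V : ptopologicalType)
  (hX : sep_lch X) (hY : sep_lch Y) (hS : sep_lch S) (hV : sep_lch V)
  (W : K.-pker (borel X * borel S) ~> borel Y)
  (W_radon : forall (x : X) (s : S), radon (W (x, s)))
  (Q : K.-pker (borel V) ~> borel S)
  (R : probability (borel V) K)
  (PA : set (probability (borel X) K))
  (PA_radon : forall P, PA P -> radon P)
  (PA_convex : convex_laws PA)
  (PA_real : forall P, PA P -> real_valued_information W Q R P)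
  (Po : probability (borel X) K)
  (Po_achieves : capacity_achieving W Q R PA Po)
  (separation : forall (P1 P2 : probability (borel X) K) (a : {i01 K}),
    PA P1 -> PA P2 -> ~ same_law P1 P2 -> (0 < a%:num < 1)%R ->
    let PW := output_law W Q (mixture a P1 P2) in
    let P1W := output_law W Q P1 in
    let P2W := output_law W Q P2 in
    0 < family_product PW R (densities_differ P1W P2W PW)
    \/ exists T : borel V -> probability (borel Y) K,
      [/\ measurable_family T,
          forall v, PW v `<< T v
        & 0 < family_product T R (densities_differ P1W P2W T)]) :
  forall P, capacity_achieving W Q R PA P -> same_law P Po.
Proof.
move=> P [PAP IP]; have [PAo Io] := Po_achieves.
apply: contrapT => neq.
have half1 : (2^-1 <= 1 :> K)%R by rewrite invf_le1// ler1n.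
have half0 : (0 <= 2^-1 :> K)%R by [].
pose a : {i01 K} := Itv01 half0 half1.
have a01 : (0 < a%:num < 1)%R by rewrite /= invr_gt0 ltr0n invf_lt1// ltr1n.
have PAM := PA_convex P Po a PAP PAo.
have ae_eq_out := ae_eq_output_law a01
  (PA_real _ PAP) (PA_real _ PAo) (PA_real _ PAM).
(* Both inputs attain the supremum, so the weighted average equals it, and the mixture, a member of
   [PA], cannot exceed it. *)
have /ae_eq_out{}ae_eq_out : mutual_information W Q R (mixture a P Po) <=
    (a%:num)%:E * mutual_information W Q R P +
    (1 - a%:num)%:E * mutual_information W Q R Po.
  rewrite IP Io -ge0_muleDl ?lee_fin//.
  rewrite -EFinD addrC subrK mul1e; apply: ereal_sup_ubound.
  by exists (mixture a P Po).
have not_gt0 (T : borel V -> probability (borel Y) K) :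
    (forall v, output_law W Q (mixture a P Po) v `<< T v) ->
    ~ 0 < family_product T R
      (densities_differ (output_law W Q P) (output_law W Q Po) T).
  move=> MT.
  by rewrite (family_product_densities_differ0 a01 MT ae_eq_out) ltxx.
have [|[T [_ MT]]] := separation P Po a PAP PAo neq a01; last exact: not_gt0.
(* The first alternative is the case where [T] is the output of the mixture, which dominates
   itself. *)
by apply: not_gt0 => v A.
Qed.
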